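(* Let $\mathcal{H}$ be a real Hilbert space and let $f,g:\mathcal{H}\to(-\infty,+\infty]$ be proper, convex and closed. Suppose that $\operatorname{dom}\partial g\neq\emptyset$, that $f$ is Fréchet differentiable everywhere on $\mathcal{H}$ with $L$-Lipschitz continuous gradient, $L>0$, and that $F^*=\inf_{x\in\mathcal{H}}F(x)>-\infty$, where $F=f+g$. Let $X^*=\{x\in\mathcal{H}:F(x)=F^*\}$. Assume that $\{\lambda_k\}_{k\in\mathbb{N}}$ is positive and nondecreasing, and that there exist $\epsilon>0$, $0<\gamma<2$ and $0\le\overline{\beta}<1$ such that the real sequences $\{\lambda_k,\alpha_k,\beta_k\}_{k\in\mathbb{N}}$ satisfy, for all $k\in\mathbb{N}$, $$0\le\alpha_k\le 1,\qquad 0\le\beta_k\le\overline{\beta},\qquad \lambda_k\alpha_k\le\frac{\beta_k}{L},\qquad \lambda_k\le\frac{2-\gamma}{L},$$ $$2-\lambda_kL(1-\alpha_k)-\beta_k-\beta_{k+1}\ge\epsilon .$$ Let $x^0,x^1\in\mathcal{H}$ and, for all $k\in\mathbb{N}$, let $$y^{k+1}=x^k+\beta_k(x^k-x^{k-1}),\quad z^{k+1}=x^k+\alpha_k(x^k-x^{k-1}),\quad x^{k+1}=\operatorname{prox}_{\lambda_k g}\big(y^{k+1}-\lambda_k\nabla f(z^{k+1})\big).$$ Then: (i) $\sum_{k\in\mathbb{N}}\|x^k-x^{k-1}\|^2<\infty$; (ii) $d(0,\partial F(x^k))\to0$ as $k\to\infty$; (iii) if $X^*$ is nonempty, then there exists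 $\hat{x}\in X^*$ such that $x^k\rightharpoonup\hat{x}$, $y^k\rightharpoonup\hat{x}$ and $z^k\rightharpoonup\hat{x}$ (weak convergence).
   Context: $\mathbb{N}=\{1,2,\dots\}$. $\partial g(x)$ is the convex subdifferential of $g$ at $x$, and $\operatorname{dom}\partial g$ is the set of $x$ at which $\partial g(x)\ne\emptyset$. For a proper, closed, convex function $g$, $\operatorname{prox}_g(y)=\arg\min_{x\in\mathcal{H}}\{\tfrac12\|x-y\|^2+g(x)\}$. For a set $S\subset\mathcal{H}$, $d(0,S)=\inf_{s\in S}\|s\|$ is the distance from $0$ to $S$. *)

(* Defs.v *)
From HB Require Import structures.
From mathcomp Require Import all_boot all_order all_algebra sesquilinear.
From mathcomp Require Import all_classical all_reals all_analysis.

Set Implicit Arguments.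
Unset Strict Implicit.
Unset Printing Implicit Defensive.

Import Order.TTheory GRing.Theory Num.Theory.
Import numFieldNormedType.Exports.

Local Open Scope classical_set_scope.
Local Open Scope ring_scope.

(* A real Hilbert space is a complete normed space H together with a symmetric
   positive definite bilinear form that induces its norm. *)
Definition inner_product (R : realType) (H : completeNormedModType R)
    (dot : {dot H for idfun}) : Prop :=
  forall x : H, dot x x = `|x| ^+ 2.

Section extended_valued.
Context {R : realType} {H : completeNormedModType R}.
Implicit Types h : H -> \bar R.

Definition proper_fun h : Prop :=
  (forall x, h x != -oo%E) /\ (exists x, (h x < +oo)%E).

(* To be used with h > -oo, so that +oo - oo does not occur; the endpoints
   t = 0, 1 are harmless as 0 * +oo = 0 in \bar R. *)
Definition econvex_fun h : Prop :=
  forall (x y : H) (t : R), 0 <= t <= 1 ->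
    (h (t *: x + (1 - t) *: y)%R <= t%:E * h x + (1 - t)%:E * h y)%E.

Definition epigraph h : set (H * R) := [set p | (h p.1 <= p.2%:E)%E].

Definition closed_fun h : Prop := closed (epigraph h).

Definition frechet_differentiable h (x : H) : Prop :=
  (\forall y \near x, h y \is a fin_num) /\ differentiable (fine \o h) x.

(* prox_h (y); for h proper, closed and convex the minimizer exists and is
   unique, so the choice made by [get] is immaterial. *)
Definition prox h (y : H) : H :=
  get [set x | forall u : H,
    ((`|x - y| ^+ 2 / 2)%:E + h x <= (`|u - y| ^+ 2 / 2)%:E + h u)%E].

Variable dot : {dot H for idfun}.

(* The Riesz representative of the Frechet derivative; it exists and is unique
   where h is differentiable. *)
Definition gradient h (x : H) : H :=
  get [set v | forall w : H, 'd (fine \o h) x w = dot v w].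

(* For h proper this is empty where h = +oo. *)
Definition subdifferential h (x : H) : set H :=
  [set v | forall u : H, (h x + (dot v (u - x))%:E <= h u)%E].

Definition dom_subdifferential h : set H :=
  [set x | subdifferential h x !=set0].

(* d(0, S), extended-valued so that d(0, set0) = +oo. *)
Definition dist0 (S : set H) : \bar R := ereal_inf [set `|s|%:E | s in S].

Definition weak_cvg (u : nat -> H) (l : H) : Prop :=
  forall w : H, dot (u k) w @[k --> \oo] --> dot l w.

End extended_valued.

(* Main.v *)
(* Writing d_k = x^k - x^(k-1), convexity and the descent lemma at z^(k+1) give,
   for every u in dom g,
     F(x^(k+1)) + <y^(k+1) - x^(k+1), u - x^(k+1)> / lambda_k
       <= F(u) + L/2 |x^(k+1) - z^(k+1)|^2.
   With u = x^k, the energy F(x^k) + beta_k/(2 lambda_k) |d_k|^2 decreases by at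
   least (eps L / 4) |d_(k+1)|^2, whence (i).  The vector
     grad f(x^(k+1)) - grad f(z^(k+1)) + (y^(k+1) - x^(k+1)) / lambda_k
   is a subgradient of F at x^(k+1) of norm O(|d_k| + |d_(k+1)|), whence (ii).
   With u = p in X^*, the sequence |x^k - p|^2 satisfies an inertial
   quasi-Fejer inequality with summable error, so it converges.  Bounded
   sequences converge weakly along ultrafilters (by Riesz), the limits are
   minimizers because F(x^k) -> F^*, and Opial's argument shows that all these
   limits coincide, whence (iii). *)
Require Import Defs.
From HB Require Import structures.
From mathcomp Require Import all_boot all_order all_algebra sesquilinear.
From mathcomp Require Import all_classical all_reals all_analysis.
From mathcomp Require Import ring lra.

Set Implicit Arguments.
Unset Strict Implicit.
Unset Printing Implicit Defensive.

Import Order.TTheory GRing.Theory Num.Theory.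
Import numFieldNormedType.Exports.

Local Open Scope classical_set_scope.
Local Open Scope ring_scope.

(** * Inner-product calculus: expansion of squares, Cauchy-Schwarz, Young inequalities *)

Section inner_product_space.
Context {R : realType} {H : completeNormedModType R} {dot : {dot H for idfun}}.
Implicit Types u v w : H.

Lemma dotC u v : dot u v = dot v u.
Proof. by rewrite hermC expr0 mul1r. Qed.

Lemma dotDl u v w : dot (u + v) w = dot u w + dot v w.
Proof. exact: linearDl. Qed.

Lemma dotDr u v w : dot w (u + v) = dot w u + dot w v.
Proof. by rewrite dotC dotDl !(dotC w). Qed.

Lemma dotNl u w : dot (- u) w = - dot u w.
Proof. exact: linearNl. Qed.

Lemma dotNr u w : dot w (- u) = - dot w u.
Proof. by rewrite dotC dotNl dotC. Qed.

Lemma dotZl (a : R) u w : dot (a *: u) w = a * dot u w.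
Proof. exact: linearZl_LR. Qed.

Lemma dotZr (a : R) u w : dot w (a *: u) = a * dot w u.
Proof. by rewrite dotC dotZl dotC. Qed.

Lemma dot0l w : dot 0 w = 0.
Proof. exact: linear0l. Qed.

Lemma dot0r w : dot w 0 = 0.
Proof. by rewrite dotC dot0l. Qed.

Definition dotE := (dotDl, dotDr, dotNl, dotNr, dotZl, dotZr).

Hypothesis hdot : inner_product dot.

Lemma sqr_norm u : `|u| ^+ 2 = dot u u.
Proof. by rewrite hdot. Qed.

Lemma sqr_normD u v : `|u + v| ^+ 2 = `|u| ^+ 2 + 2 * dot u v + `|v| ^+ 2.
Proof. by rewrite !sqr_norm !dotE (dotC v u); ring. Qed.

Lemma sqr_normB u v : `|u - v| ^+ 2 = `|u| ^+ 2 - 2 * dot u v + `|v| ^+ 2.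
Proof. by rewrite !sqr_norm !dotE (dotC v u); ring. Qed.

(** With a = |u| and b = |v|, the square |b u - a v|^2 expands to 2ab(ab - <u,v>). Zero vectors are
    split off so that ab can be cancelled. *)
Lemma dot_le_norm u v : dot u v <= `|u| * `|v|.
Proof.
have [->|v0] := eqVneq v 0; first by rewrite dot0r mulr_ge0.
have : 0 <= `| (`|v| *: u - `|u| *: v) | ^+ 2 by rewrite exprn_ge0.
rewrite sqr_normB !normrZ dotZl dotZr !normr_id.
have [->|u0] := eqVneq u 0; first by rewrite dot0l mulr_ge0.
have : 0 < `|u| * `|v| by rewrite mulr_gt0 ?normr_gt0.
move: (`|u|) (`|v|) (dot u v) => a b d ab0 h.
rewrite -(ler_pM2l ab0); nra.
Qed.

Lemma norm_dot_le u v : `|dot u v| <= `|u| * `|v|.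
Proof.
by rewrite ler_norml dot_le_norm andbT lerNl -dotNl -(normrN u) dot_le_norm.
Qed.

Lemma young_dot u v : 2 * dot u v <= `|u| ^+ 2 + `|v| ^+ 2.
Proof.
have : 0 <= `|u - v| ^+ 2 by rewrite exprn_ge0.
by rewrite sqr_normB; lra.
Qed.

Lemma young_dotN u v : - (2 * dot u v) <= `|u| ^+ 2 + `|v| ^+ 2.
Proof. by have := young_dot (- u) v; rewrite dotNl normrN; lra. Qed.

Lemma sqr_normD_le u v : `|u + v| ^+ 2 <= 2 * (`|u| ^+ 2 + `|v| ^+ 2).
Proof. by rewrite sqr_normD; have := young_dot u v; lra. Qed.

(** Stands in for letting t tend to 0: if a were negative, the witness [t] would give a + tb <= a/2
    < 0. *)
Lemma ge0_of_linear_perturbation (a b : R) :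
  (forall t, 0 < t <= 1 -> 0 <= a + t * b) -> 0 <= a.
Proof.
move=> h; rewrite leNgt; apply/negP => a0.
pose t := Num.min 1 (- a / (2 * (`|b| + 1))).
have b1 : 0 < `|b| + 1 by rewrite ltr_wpDl.
have q0 : 0 < - a / (2 * (`|b| + 1)) by rewrite divr_gt0 ?oppr_gt0 ?mulr_gt0.
have t0 : 0 < t by rewrite lt_min ltr01.
have t1 : t <= 1 by rewrite ge_min lexx.
have tb : t * (2 * (`|b| + 1)) <= - a.
  by rewrite -ler_pdivlMr ?mulr_gt0// ge_min lexx orbT.
have := h t; rewrite t0 t1 => /(_ isT).
have := ler_norm b; nra.
Qed.

(** * Proximal points over a closed convex subset of H x R *)

Section epigraph_minimization.
Variables (E : set (H * R)).
Hypothesis E_convex : forall p q (t : R), E p -> E q -> 0 <= t <= 1 ->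
  E (t *: p.1 + (1 - t) *: q.1, t * p.2 + (1 - t) * q.2).

(** Comparing [p] with the point at parameter t on the segment towards [q] and dividing by t gives
    the claim up to t |q.1 - p.1|^2 / 2, which vanishes with t. An arbitrary convex [E] covers both
    epigraphs and graphs of linear forms. *)
Lemma prox_variational (y : H) (p : H * R) : E p ->
  (forall q, E q -> `|p.1 - y| ^+ 2 / 2 + p.2 <= `|q.1 - y| ^+ 2 / 2 + q.2) ->
  forall q, E q -> p.2 + dot (y - p.1) (q.1 - p.1) <= q.2.
Proof.
move=> Ep pmin q Eq; rewrite -subr_ge0.
apply: (@ge0_of_linear_perturbation _ (`|q.1 - p.1| ^+ 2 / 2)) => t.
move=> /andP[t0 t1].
have /pmin/= : E (t *: q.1 + (1 - t) *: p.1, t * q.2 + (1 - t) * p.2).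
  by apply: E_convex => //; rewrite ltW.
have -> : t *: q.1 + (1 - t) *: p.1 - y = (p.1 - y) + t *: (q.1 - p.1).
  by rewrite scalerBl scale1r scalerBr addrCA addrAC.
rewrite (sqr_normD (p.1 - y)) dotZr normrZ exprMn (ger0_norm (ltW t0)).
rewrite -(opprB p.1 y) dotNl.
move: (`|p.1 - y| ^+ 2) (dot _ _) (`|_| ^+ 2) (p.2) (q.2) => a d n r s h.
rewrite -(pmulr_rge0 _ t0); nra.
Qed.

Hypothesis E_closed : closed E.

(** The quadratic term makes the first components of a minimizing sequence Cauchy. The second
    components then converge because the values [G] do, and closedness keeps the limit pair in
    [E]. *)
Lemma prox_exists (y : H) (m : R) : E !=set0 ->
  (forall q, E q -> m <= `|q.1 - y| ^+ 2 / 2 + q.2) ->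
  exists2 p, E p &
    forall q, E q -> `|p.1 - y| ^+ 2 / 2 + p.2 <= `|q.1 - y| ^+ 2 / 2 + q.2.
Proof.
move=> [q0 Eq0] mE.
pose G (q : H * R) : R := `|q.1 - y| ^+ 2 / 2 + q.2.
have GE0 : G @` E !=set0 by exists (G q0), q0.
have GElb : has_inf (G @` E) by split => //; exists m => _ [q Eq <-]; exact: mE.
pose i : R := inf (G @` E).
have iG q : E q -> i <= G q by move=> Eq; apply: ge_inf; [case: GElb|exists q].
have /choice[q qP] : forall n : nat, exists q, E q /\ G q < i + n.+1%:R^-1.
  move=> n; have [_ [q Eq <-] qi] : exists2 r, (G @` E) r & r < i + n.+1%:R^-1.
    by apply: inf_adherent => //; rewrite invr_gt0.
  by exists q.
(* The midpoint of two terms lies in [E], so its value is at least [i]; the parallelogram law turns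
   this into |u - v|^2 / 8 <= half the sum of the two errors. *)
have dq j k : `|(q j).1 - (q k).1| ^+ 2 <= 4 * (j.+1%:R^-1 + k.+1%:R^-1).
  have [[Ej Gj] [Ek Gk]] := (qP j, qP k).
  have half : 0 <= (2^-1 : R) <= 1 by apply/andP; split; lra.
  have := iG _ (E_convex Ej Ek half).
  move: Gj Gk; rewrite /G/=.
  have -> : 2^-1 *: (q j).1 + (1 - 2^-1) *: (q k).1 - y =
            2^-1 *: ((q j).1 - y + ((q k).1 - y)).
    have -> : (1 - 2^-1 : R) = 2^-1 by lra.
    rewrite -scalerDr addrACA -opprD scalerBr; congr (_ - _).
    by rewrite -mulr2n -[y *+ 2]scaler_nat scalerA mulVf// scale1r.
  have -> : (q j).1 - (q k).1 = ((q j).1 - y) - ((q k).1 - y).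
    by rewrite opprB addrA subrK.
  move: ((q j).1 - y) ((q k).1 - y) => u v.
  rewrite sqr_normB normrZ exprMn sqr_normD ger0_norm ?invr_ge0//.
  move: (`|u| ^+ 2 : R) (`|v| ^+ 2 : R) (dot u v) (q j).2 (q k).2.
  move: (j.+1%:R^-1 : R) (k.+1%:R^-1 : R) (i : R).
  by clear; move=> *; lra.
have cq : cvgn (fun n => (q n).1).
  apply: cauchy_cvg; apply: cauchy_exP => e e0.
  (* Once both reciprocals are below e^2 / 8, the bound [dq] is below e^2. *)
  have e80 : 0 < e ^+ 2 / 8 by rewrite divr_gt0 ?exprn_gt0.
  have [N _ Ne] := near_infty_natSinv_lt (PosNum e80).
  exists (q N).1; exists N => // n /= Nn; rewrite -ball_normE /=.
  rewrite -(@ltr_pXn2r _ 2)// ?nnegrE ?(ltW e0)//.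
  apply: (le_lt_trans (dq _ _)).
  have := Ne _ Nn; have := Ne _ (leqnn N) => /=.
  by move: (N.+1%:R^-1 : R) (n.+1%:R^-1 : R) (e ^+ 2) => a b c; lra.
pose p := limn (fun n => (q n).1).
have Gi : G (q n) @[n --> \oo] --> i.
  apply: (@squeeze_cvgr _ _ _ _ (fun=> i) (fun n => i + n.+1%:R^-1)).
  - by apply: nearW => n; have [Eq Gq] := qP n; rewrite iG// ltW.
  - exact: cvg_cst.
  - rewrite -[X in _ --> X]addr0; apply: cvgD; first exact: cvg_cst.
    exact: cvg_harmonic.
have q2 : (q n).2 @[n --> \oo] --> i - `|p - y| ^+ 2 / 2.
  rewrite (_ : (fun n => (q n).2) =
               (fun n => G (q n) - `|(q n).1 - y| ^+ 2 / 2)).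
    apply: cvgB => //; apply: cvgMr_tmp; rewrite expr2.
    by apply: cvgM; apply: cvg_norm; apply: cvgB => //; exact: cvg_cst.
  by apply/funext => n; rewrite /G addrC addKr.
have Ep : E (p, i - `|p - y| ^+ 2 / 2).
  apply: (@closed_cvg _ _ \oo _ (fun n => ((q n).1, (q n).2)) E E_closed).
    by apply: nearW => n; rewrite -surjective_pairing; case: (qP n).
  exact: (@cvg_pair _ _ _ _ (nbhs p) (nbhs (i - `|p - y| ^+ 2 / 2))).
exists (p, i - `|p - y| ^+ 2 / 2) => //= s Es.
by rewrite addrC subrK; exact: (iG s Es).
Qed.

End epigraph_minimization.

End inner_product_space.

(** * Riesz representation, gradients and the descent lemma *)

Section smooth_functions.
Context {R : realType} {H : completeNormedModType R} {dot : {dot H for idfun}}.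
Hypothesis hdot : inner_product dot.
Implicit Types u v w : H.

(* The representative of phi is the minimizer of |u|^2 / 2 - phi u. *)
Lemma riesz (phi : H -> R) (C : R) :
  (forall u v, phi (u + v) = phi u + phi v) ->
  (forall a u, phi (a *: u) = a * phi u) ->
  (forall u, `|phi u| <= C * `|u|) ->
  exists v, forall w, phi w = dot v w.
Proof.
move=> phiD phiZ phiC.
have phiN u : phi (- u) = - phi u by rewrite -scaleN1r phiZ mulN1r.
have phi_cont : continuous phi.
  move=> u; apply/cvgrPdist_le => e e0.
  have C1 : 0 < `|C| + 1 by rewrite ltr_wpDl.
  near=> v; rewrite -phiN -phiD (le_trans (phiC _))//.
  apply: (@le_trans _ _ ((`|C| + 1) * `|u - v|)).
    by rewrite ler_wpM2r// (le_trans (ler_norm C))// lerDl.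
  rewrite -ler_pdivlMl//; near: v; apply: cvgr_dist_le => //.
  by rewrite mulrC divr_gt0.
pose E := [set q : H * R | q.2 + phi q.1 = 0].
have Econv p q (t : R) : E p -> E q -> 0 <= t <= 1 ->
    E (t *: p.1 + (1 - t) *: q.1, t * p.2 + (1 - t) * q.2).
  rewrite /E/= => pE qE _; rewrite phiD !phiZ.
  by rewrite addrACA -!mulrDr pE qE !mulr0 addr0.
have Ecl : closed E.
  apply: (@preimage_closed _ _ (fun q : H * R => q.2 + phi q.1) [set 0]).
    move=> q _; apply: cvgD; first exact: cvg_snd.
    by apply: continuous_comp; [exact: cvg_fst|exact: phi_cont].
  exact: closed_eq.
have E0 : E !=set0 by exists (0, - phi 0); rewrite /E/= addNr.
have Emin q : E q -> - (C ^+ 2 / 2) <= `|q.1 - 0| ^+ 2 / 2 + q.2.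
  move=> /eqP; rewrite addr_eq0 => /eqP ->; rewrite subr0.
  have := le_trans (ler_norm _) (phiC q.1).
  have := sqr_ge0 (C - `|q.1|).
  by move: (phi _) (`|_|) => a b; nra.
have [p Ep /(prox_variational hdot Econv Ep) pP] :=
  prox_exists hdot Econv Ecl E0 Emin.
have le_dot w : phi w <= dot p.1 w.
  have := pP (p.1 + w, - phi (p.1 + w)); rewrite /E/= addNr => /(_ erefl).
  move: Ep => /eqP; rewrite addr_eq0 => /eqP ->.
  by rewrite phiD sub0r addrAC subrr add0r dotNl; lra.
exists p.1 => w; apply/eqP; rewrite eq_le le_dot/=.
by have := le_dot (- w); rewrite phiN dotNr lerN2.
Unshelve. all: by end_near. Qed.

(** A Fréchet derivative is linear and continuous, hence bounded, so [riesz] supplies a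
    representative for [get] to select. *)
Lemma gradientP (h : H -> \bar R) x : differentiable (fine \o h) x ->
  forall w, 'd (fine \o h) x w = dot (gradient dot h x) w.
Proof.
move=> dh; apply: (@getPex _ [set v | forall w, 'd (fine \o h) x w = dot v w]).
have /linear_boundedP/pinfty_ex_gt0[C C0 dC] :
    bounded_near ('d (fine \o h) x) (nbhs 0).
  by apply: continuous_linear_bounded; exact: diff_continuous.
apply: (@riesz _ C) => //=; [exact: linearD|by move=> a u; rewrite linearZ].
Qed.

Variables (phi : H -> R) (grad : H -> H).
Hypothesis phi_diff : forall x, differentiable phi x.
Hypothesis phi_grad : forall x w, 'd phi x w = dot (grad x) w.

(** Convexity bounds the difference quotients towards [u] by phi u - phi x for steps in (0, 1];
    their right limit at 0 is the directional derivative. *)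
Lemma convex_gradient_le x u :
  (forall t : R, 0 <= t <= 1 ->
    phi (t *: u + (1 - t) *: x) <= t * phi u + (1 - t) * phi x) ->
  phi x + dot (grad x) (u - x) <= phi u.
Proof.
move=> conv; rewrite -lerBrDl -phi_grad -deriveE//.
have dphi : derivable phi x (u - x) by exact: diff_derivable.
have : h^-1 *: (phi (h *: (u - x) + x) - phi x) @[h --> 0^'+]
    --> 'D_(u - x) phi x.
  by apply: cvg_dnbhs_at_right; exact: dphi.
move/cvgr_to_le; apply.
near=> h.
have h0 : 0 < h by near: h; exact: nbhs_right_gt.
have h1 : h <= 1 by near: h; exact: nbhs_right_le.
rewrite ler_pdivrMl//.
have := conv h; rewrite h1 (ltW h0) => /(_ isT).
rewrite (_ : h *: u + (1 - h) *: x = h *: (u - x) + x); first by lra.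
by rewrite scalerBl scale1r scalerBr addrA addrAC.
Unshelve. all: by end_near. Qed.

(** The mean value theorem is applied to [psi], which is phi along the segment minus the linear and
    quadratic terms of the bound; the Lipschitz condition makes [dpsi c] nonpositive. *)
Lemma descent_le L x u : L.-lipschitz grad ->
  phi u <= phi x + dot (grad x) (u - x) + L / 2 * `|u - x| ^+ 2.
Proof.
move=> lip; set h := u - x.
pose psi (t : R) := phi (x + t *: h) -
  (t * dot (grad x) h + t ^+ 2 * (L / 2 * `|h| ^+ 2)).
pose dpsi (t : R) := dot (grad (x + t *: h)) h -
  (dot (grad x) h + 2 * t * (L / 2 * `|h| ^+ 2)).
have dP (t : R) : is_derive t 1 psi (dpsi t).
  have quad_derive (a b : R) :
      is_derive t 1 (fun s : R => s * a + s ^+ 2 * b) (a + 2 * t * b).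
    apply/is_derive1_caratheodory; exists (fun s => a + (s + t) * b).
    split=> [s||]; [by ring| |by ring].
    apply: cvgD; first exact: cvg_cst.
    by apply: cvgMr_tmp; apply: cvgD; [exact: cvg_id|exact: cvg_cst].
  have phi_derive : is_derive t 1 (fun s : R => phi (x + s *: h))
      (dot (grad (x + t *: h)) h).
    rewrite -phi_grad -deriveE//.
    have e : (fun s : R =>
        s^-1 *: (phi (x + (s *: 1 + t) *: h) - phi (x + t *: h))) =
      (fun s : R => s^-1 *: (phi (s *: h + (x + t *: h)) - phi (x + t *: h))).
      apply/funext => s; congr (_ *: (phi _ - _)).
      by rewrite [s *: _]mulr1 scalerDl addrCA.
    split; first by rewrite /derivable e; exact: diff_derivable.
    by rewrite /derive e.
  exact: is_deriveB phi_derive (quad_derive _ _).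
have psi_cont : {within `[0, 1], continuous psi}.
  apply: continuous_subspaceT => t.
  apply/differentiable_continuous/derivable1_diffP.
  by have [] := dP t.
have [c c01] := MVT ltr01 (fun c _ => dP c) psi_cont.
have {c01} c0 : 0 <= c by rewrite (itvP c01).
have xh : x + h = u by rewrite addrC subrK.
rewrite /psi /dpsi !scale1r scale0r addr0 xh.
have : dot (grad (x + c *: h)) h - dot (grad x) h <= L * c * `|h| ^+ 2.
  rewrite -dotNl -dotDl (le_trans (dot_le_norm hdot _ _))//.
  have /= := lip (x + c *: h, x) (conj I I).
  rewrite addrAC subrr add0r normrZ ger0_norm//.
  move=> /(ler_wpM2r (normr_ge0 h)) /le_trans; apply.
  by rewrite expr2 !mulrA.
move: (`|h| ^+ 2) => n.
lra.
Qed.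

End smooth_functions.

(** * Real sequences: summability, inertial recursions, limits along ultrafilters *)

Section real_sequences.
Context {R : realType}.
Implicit Types a b e : R^nat.

Lemma descent_series_bounded a e (c m : R) : 0 < c ->
  (forall n, e n.+1 + c * a n <= e n) -> (forall n, m <= e n) ->
  forall n, series a n <= (e 0 - m) / c.
Proof.
move=> c0 ea em n; rewrite ler_pdivlMr// mulrC.
suff : c * series a n <= e 0 - e n by have := em n; lra.
elim: n => [|n ih]; first by rewrite seriesEnat/= big_geq// mulr0 subrr.
by rewrite seriesSr/= mulrDr; have := ea n; lra.
Qed.

Lemma nneg_series_bounded_cvg a (M : R) : (forall n, 0 <= a n) ->
  (forall n, series a n <= M) -> cvgn (series a).
Proof.
move=> a0 aM; apply: nondecreasing_is_cvgn; first exact: nondecreasing_series.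
by exists M => _ [n _ <-].
Qed.

(** The positive parts [theta] of the increments contract by the factor [bbar] up to the summable
    error [a], so they are summable; subtracting their partial sums from [phi] leaves a
    nonincreasing sequence bounded below. *)
Lemma inertial_sequence_cvg (phi a b : R^nat) (bbar M : R) : bbar < 1 ->
  (forall n, 0 <= phi n) -> (forall n, 0 <= a n) ->
  (forall n, series a n <= M) -> (forall n, 0 <= b n <= bbar) ->
  (forall n, phi n.+2 - phi n.+1 <= b n * (phi n.+1 - phi n) + a n) ->
  cvgn phi.
Proof.
move=> bbar1 phi0 a0 aM bP phiP.
pose theta n := Num.max (phi n.+1 - phi n) 0.
have theta0 n : 0 <= theta n by rewrite le_max lexx orbT.
have thetaP n : theta n.+1 <= bbar * theta n + a n.
  have /andP[b0 bb] := bP n.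
  have bb0 : 0 <= bbar by exact: le_trans bb.
  rewrite {1}/theta ge_max; apply/andP; split; last first.
    by rewrite addr_ge0// mulr_ge0.
  apply: le_trans (phiP n) _; rewrite lerD2r.
  apply: (@le_trans _ _ (b n * theta n)); last by rewrite ler_wpM2r.
  by rewrite ler_wpM2l// le_max lexx.
have thetaM n : series theta n <= (theta 0 + M) / (1 - bbar).
  (* Summed form of [thetaP]; bounding [series theta k] by [series theta k.+1] then lets the [bbar]
     term be absorbed on the left. *)
  have s k : series theta k.+1 <= theta 0 + bbar * series theta k + series a k.
    elim: k => [|k ih].
      by rewrite !seriesEnat/= big_nat1 !big_geq// mulr0 !addr0.
    by rewrite seriesSr [X in _ * X]seriesSr [X in _ <= _ + X]seriesSr /=;
      have := thetaP k; lra.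
  rewrite ler_pdivlMr ?subr_gt0//.
  have := s n; rewrite seriesSr/=; have := theta0 n; have := aM n; lra.
have ctheta := nneg_series_bounded_cvg theta0 thetaM.
rewrite (_ : phi = (phi \- series theta) \+ series theta); last first.
  by apply/funext => n /=; rewrite subrK.
apply: is_cvgD => //; apply: nonincreasing_is_cvgn.
  apply/nonincreasing_seqP => n; rewrite /= seriesSr/=.
  have : phi n.+1 - phi n <= theta n by rewrite le_max lexx.
  lra.
exists (- ((theta 0 + M) / (1 - bbar))) => _ [n _ <-] /=.
by have := thetaM n; have := phi0 n; lra.
Qed.

(** Compactness of [-M, M] gives a cluster point, and an ultrafilter converges to each of its
    cluster points: it cannot contain the complement of a neighbourhood. *)
Lemma ultra_bounded_cvg (U : set_system nat) (a : R^nat) (M : R) :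
  UltraFilter U -> (forall n, `|a n| <= M) -> exists l : R, a @ U --> l.
Proof.
move=> UU aM.
have aI : (a @ U) [set` `[- M, M]].
  by apply: nearW => n /=; rewrite in_itv/= -ler_norml.
have [l [_ lcl]] := segment_compact (fmap_proper_filter a _) aI.
exists l => A lA.
have [//|UA] := in_ultra_setVsetC (a @^-1` A) UU.
by have [r []] := lcl (~` A) A UA lA.
Qed.

End real_sequences.

(** * Weak compactness along ultrafilters and Opial's lemma *)

Section opial.
Context {R : realType} {H : completeNormedModType R} {dot : {dot H for idfun}}.
Hypothesis hdot : inner_product dot.

(** The limits of [dot (x n) w] along [U] form a linear functional of [w] bounded by [M], which
    [riesz] represents. This replaces the extraction of weakly convergent subsequences. *)
Lemma ultra_weak_cvg (U : set_system nat) (x : nat -> H) (M : R) :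
  UltraFilter U -> (forall n, `|x n| <= M) ->
  exists c, forall w, dot (x n) w @[n --> U] --> dot c w.
Proof.
move=> UU xM.
have xwM w n : `|dot (x n) w| <= M * `|w|.
  by rewrite (le_trans (norm_dot_le hdot _ _))// ler_wpM2r.
have /choice[phi phiP] : forall w, exists l : R, dot (x n) w @[n --> U] --> l.
  by move=> w; exact: ultra_bounded_cvg (xwM w).
have [|||c cP] := @riesz _ _ _ hdot phi M.
- move=> u v; apply: (@cvg_unique _ _ (dot (x n) (u + v) @[n --> U])) => //.
    exact: phiP.
  rewrite (_ : (fun n => _) = (fun n => dot (x n) u + dot (x n) v)); last first.
    by apply/funext => n; rewrite dotDr.
  by apply: cvgD; exact: phiP.
- move=> k u; apply: (@cvg_unique _ _ (dot (x n) (k *: u) @[n --> U])) => //.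
    exact: phiP.
  rewrite (_ : (fun n => _) = (fun n => k * dot (x n) u)); last first.
    by apply/funext => n; rewrite dotZr.
  by apply: cvgMl_tmp; exact: phiP.
- move=> u; apply: (cvgr_to_le (cvg_norm (phiP u))).
  by apply: nearW => n /=.
by exists c => w; rewrite -cP; exact: phiP.
Qed.

Lemma opial (x : nat -> H) (M : R) (X : set H) :
  (forall n, `|x n| <= M) ->
  (forall p, X p -> cvgn (fun n => `|x n - p| ^+ 2)) ->
  (forall (U : set_system nat) c, UltraFilter U -> \oo `<=` U ->
    (forall w, dot (x n) w @[n --> U] --> dot c w) -> X c) ->
  exists2 c, X c & weak_cvg dot x c.
Proof.
move=> xM Xcvg Xcl.
have [U [UU ooU]] := ultraFilterLemma (_ : ProperFilter \oo).
have [c cP] := ultra_weak_cvg UU xM.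
have Xc := Xcl _ _ UU ooU cP.
exists c => // w; apply: contrapT => ncvg.
have [e e0 ne] : exists2 e : R, 0 < e &
    ~ \forall n \near \oo, `|dot c w - dot (x n) w| < e.
  apply: contrapT => h; apply: ncvg; apply/cvgrPdist_lt => e e0.
  by apply: contrapT => ne; apply: h; exists e.
(* If weak convergence to [c] fails at [w], the complement of [A] meets every tail, so some
   ultrafilter [V] finer than [\oo] contains it. *)
pose A := [set n | `|dot c w - dot (x n) w| < e].
have GF : ProperFilter (within (~` A) \oo).
  split; last exact: within_filter.
  move=> h; apply: ne; apply: (filterS _ (h : \oo _)) => n nA.
  exact: contrapT.
have [V [VV GV]] := ultraFilterLemma GF.
have ooV : \oo `<=` V.
  by move=> B BF; apply: GV; exact: cvg_within BF.
have VA : V (~` A) by apply: GV; exact: withinT.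
have [d dP] := ultra_weak_cvg VV xM.
have Xd := Xcl _ _ VV ooV dP.
(* Polarization writes this product through the squared distances to [c] and [d], both convergent
   along [\oo]; hence its limits along [U] and [V] agree, which forces |d - c|^2 = 0. *)
have /cvg_ex[l ll] : cvgn (fun n => dot (x n) (d - c)).
  have -> : (fun n => dot (x n) (d - c)) = (fun n =>
    2^-1 * (`|x n - c| ^+ 2 - `|x n - d| ^+ 2 + (`|d| ^+ 2 - `|c| ^+ 2))).
    by apply/funext => n; rewrite !(sqr_normB hdot) !dotE; field.
  apply: is_cvgMl_tmp; apply: is_cvgD; last exact: is_cvg_cst.
  by apply: is_cvgB; exact: Xcvg.
have lc : l = dot c (d - c).
  apply: (@cvg_unique _ _ (dot (x n) (d - c) @[n --> U])) => //.
    by move=> B /ll; exact: ooU.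
  exact: cP.
have ld : l = dot d (d - c).
  apply: (@cvg_unique _ _ (dot (x n) (d - c) @[n --> V])) => //.
    by move=> B /ll; exact: ooV.
  exact: dP.
have dc : d = c.
  apply/eqP; rewrite -subr_eq0 -normr_eq0 -sqrf_eq0 (sqr_norm hdot).
  by rewrite dotDl dotNl -lc -ld subrr.
move: dP; rewrite dc => /(_ w)/cvgrPdist_lt/(_ _ e0) VA'.
by have [n []] := @filter_ex _ V _ _ (filterI VA VA').
Qed.

End opial.

(** * Subgradients and proximal points of extended-valued functions *)

Section proximal_point.
Context {R : realType} {H : completeNormedModType R} {dot : {dot H for idfun}}.
Hypothesis hdot : inner_product dot.
Variable h : H -> \bar R.
Hypothesis h_proper : proper_fun h.

Lemma subdifferential_fin_num x v :
  subdifferential dot h x v -> h x \is a fin_num.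
Proof.
have [hNy [x0 hx0]] := h_proper; move=> /(_ x0) hx.
rewrite fin_numE hNy /=; apply/negP => /eqP hxy.
by move: hx; rewrite hxy addye// leye_eq => /eqP hx0y; rewrite hx0y in hx0.
Qed.

Lemma subdifferential_fine x v u : subdifferential dot h x v ->
  h u \is a fin_num -> fine (h x) + dot v (u - x) <= fine (h u).
Proof.
move=> vx hu; have hx := subdifferential_fin_num vx.
by rewrite -lee_fin EFinD !fineK//; exact: vx.
Qed.

Hypothesis h_convex : econvex_fun h.

(** The set of [p] with [h p.1 <= (p.2 / l)%:E] is the epigraph of l h. Dividing the real component
    exhibits it as a continuous preimage of [epigraph h], from which closedness follows later. *)
Lemma scaled_epigraph_convex (l : R) (p q : H * R) (t : R) : 0 < l ->
  (h p.1 <= (p.2 / l)%:E)%E -> (h q.1 <= (q.2 / l)%:E)%E -> 0 <= t <= 1 ->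
  (h (t *: p.1 + (1 - t) *: q.1)%R <= ((t * p.2 + (1 - t) * q.2) / l)%:E)%E.
Proof.
move=> l0 hp hq t01; have /andP[t0 t1] := t01.
apply: le_trans (h_convex _ _ t01) _.
rewrite mulrDl -!mulrA [leRHS]EFinD !EFinM.
by apply: leeD; apply: lee_wpmul2l => //; rewrite lee_fin ?subr_ge0.
Qed.

(** Optimality condition for the proximal problem: [prox_variational] on the epigraph of l h,
    divided by l. Comparison with [x0] first shows that [h p] is finite. *)
Lemma minimizer_subdifferential (l : R) (y p : H) : 0 < l ->
  (forall u, (`|p - y| ^+ 2 / 2)%:E + l%:E * h p <=
             (`|u - y| ^+ 2 / 2)%:E + l%:E * h u)%E ->
  subdifferential dot h p (l^-1 *: (y - p)).
Proof.
move=> l0 pmin; have [hNy [x0 hx0]] := h_proper.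
have hp : h p \is a fin_num.
  rewrite fin_numE hNy /=; apply/negP => /eqP hpy.
  have := pmin x0; rewrite hpy gt0_muley ?lte_fin// addey// leye_eq.
  move: hx0 (hNy x0); case: (h x0) => // r _ _.
pose E := [set q : H * R | (h q.1 <= (q.2 / l)%:E)%E].
have Econv p1 q (t : R) : E p1 -> E q -> 0 <= t <= 1 ->
    E (t *: p1.1 + (1 - t) *: q.1, t * p1.2 + (1 - t) * q.2).
  by move=> p1E qE t01; exact: scaled_epigraph_convex.
have EP u : h u \is a fin_num -> E (u, l * fine (h u)).
  by move=> hu; rewrite /E/= mulrAC mulfV ?gt_eqF// mul1r fineK.
have Emin q : E q ->
    `|p - y| ^+ 2 / 2 + l * fine (h p) <= `|q.1 - y| ^+ 2 / 2 + q.2.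
  rewrite /E /= => qE; rewrite -lee_fin !EFinD (EFinM l) fineK//.
  apply: le_trans (pmin q.1) _; rewrite leeD2l//.
  apply: (le_trans (lee_wpmul2l _ qE)); first by rewrite lee_fin ltW.
  by rewrite -EFinM mulrCA mulfV ?gt_eqF// mulr1.
move=> u; have [hu|] := boolP (h u \is a fin_num); last first.
  by rewrite fin_numE hNy /= negbK => /eqP ->; rewrite leey.
have := prox_variational hdot Econv (EP _ hp) Emin (EP _ hu).
rewrite /= => vi; rewrite -(fineK hp) -(fineK hu) -EFinD lee_fin dotZl.
by rewrite -(ler_pM2l l0) mulrDr mulrA mulfV ?gt_eqF// mul1r.
Qed.

Hypothesis h_closed : closed_fun h.

(** The lower bound [m] is left to the caller: an affine minorant provides it for g, the finite
    infimum for F. *)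
Lemma prox_minimizer_exists (l m : R) (y : H) : 0 < l ->
  (forall u, m%:E <= (`|u - y| ^+ 2 / 2)%:E + l%:E * h u)%E ->
  exists p, forall u, ((`|p - y| ^+ 2 / 2)%:E + l%:E * h p <=
                      (`|u - y| ^+ 2 / 2)%:E + l%:E * h u)%E.
Proof.
move=> l0 hm; have [hNy [x0 hx0]] := h_proper.
pose E := [set q : H * R | (h q.1 <= (q.2 / l)%:E)%E].
have Econv p1 q (t : R) : E p1 -> E q -> 0 <= t <= 1 ->
    E (t *: p1.1 + (1 - t) *: q.1, t * p1.2 + (1 - t) * q.2).
  by move=> p1E qE t01; exact: scaled_epigraph_convex.
have EP u : h u \is a fin_num -> E (u, l * fine (h u)).
  by move=> hu; rewrite /E/= mulrAC mulfV ?gt_eqF// mul1r fineK.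
have EM q : E q -> (l%:E * h q.1 <= q.2%:E)%E.
  move=> qE; apply: (le_trans (lee_wpmul2l _ qE)); first by rewrite lee_fin ltW.
  by rewrite -EFinM mulrCA mulfV ?gt_eqF// mulr1.
have Ecl : closed E.
  apply: (@preimage_closed _ _ (fun q : H * R => (q.1, q.2 / l)) (epigraph h));
    last exact: h_closed.
  move=> q _; apply: (@cvg_pair _ _ _ _ (nbhs q.1) (nbhs (q.2 / l))).
    exact: cvg_fst.
  by apply: cvgMr_tmp; exact: cvg_snd.
have E0 : E !=set0.
  by exists (x0, l * fine (h x0)); apply: EP; rewrite fin_numE hNy /= lt_eqF.
have Em q : E q -> m <= `|q.1 - y| ^+ 2 / 2 + q.2.
  move=> qE; rewrite -lee_fin (le_trans (hm q.1))// EFinD.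
  by rewrite leeD2l// EM.
have [p Ep pmin] := prox_exists hdot Econv Ecl E0 Em.
exists p.1 => u; have [hu|] := boolP (h u \is a fin_num); last first.
  rewrite fin_numE hNy /= negbK => /eqP ->.
  by rewrite gt0_muley ?lte_fin// addey// leey.
apply: (@le_trans _ _ (`|p.1 - y| ^+ 2 / 2 + p.2)%:E).
  by rewrite EFinD leeD2l// EM.
by rewrite -[h u]fineK// -(EFinM l) -EFinD lee_fin; exact: pmin (EP _ hu).
Qed.

Lemma prox_subdifferential (l : R) (y : H) : 0 < l ->
  dom_subdifferential dot h !=set0 ->
  let p := prox (fun u => l%:E * h u)%E y in
  subdifferential dot h p (l^-1 *: (y - p)).
Proof.
move=> l0 [x0 [v vx0]]; apply: minimizer_subdifferential => //.
have hx0 := subdifferential_fin_num vx0.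
(* It is enough that some minimizer exists: [get] then returns a genuine one. *)
suff /(@getPex H) : [set x | forall u, ((`|x - y| ^+ 2 / 2)%:E + l%:E * h x <=
    (`|u - y| ^+ 2 / 2)%:E + l%:E * h u)%E] !=set0 by [].
(* The affine minorant of h given by v, after completing the square. *)
pose m := l * fine (h x0) + l * dot v (y - x0) - l ^+ 2 * `|v| ^+ 2 / 2.
apply: (@prox_minimizer_exists _ m) => // u.
have := vx0 u; rewrite -[h x0]fineK// => /(lee_wpmul2l (_ : 0 <= l%:E))%E.
rewrite lee_fin => /(_ (ltW l0)) hu.
apply: le_trans (leeD2l _ hu).
rewrite -[X in (_ + _ * X)%E]EFinD -EFinM -EFinD lee_fin /m.
have := young_dotN hdot (l *: v) (u - y).
rewrite normrZ exprMn real_normK ?num_real//.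
by rewrite !dotE; move: (`|_| ^+ 2) (`|_| ^+ 2) => *; lra.
Qed.

End proximal_point.

(** * The composite objective: smooth part plus g *)

Section composite_objective.
Context {R : realType} {H : completeNormedModType R} {dot : {dot H for idfun}}.
Hypothesis hdot : inner_product dot.
Variables (phi : H -> R) (grad : H -> H) (L : R) (g : H -> \bar R).
Hypothesis L_gt0 : 0 < L.
Hypothesis phi_convex : forall u v (t : R), 0 <= t <= 1 ->
  phi (t *: u + (1 - t) *: v) <= t * phi u + (1 - t) * phi v.
Hypothesis phi_cont : continuous phi.
Hypothesis phi_grad : forall x u, phi x + dot (grad x) (u - x) <= phi u.
Hypothesis phi_descent : forall x u,
  phi u <= phi x + dot (grad x) (u - x) + L / 2 * `|u - x| ^+ 2.
Hypothesis grad_lip : forall x u, `|grad x - grad u| <= L * `|x - u|.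
Hypothesis g_proper : proper_fun g.

Let F x : \bar R := ((phi x)%:E + g x)%E.

Lemma composite_proper : proper_fun F.
Proof.
have [gNy [x0 gx0]] := g_proper; split.
  by move=> x; have := gNy x; rewrite /F; case: (g x).
by exists x0; rewrite /F lte_add_pinfty// ltry.
Qed.

Lemma composite_convex : econvex_fun g -> econvex_fun F.
Proof.
move=> gconv x y t t01; have /andP[t0 t1] := t01.
have : ((phi (t *: x + (1 - t) *: y))%:E <= (t * phi x + (1 - t) * phi y)%:E)%E.
  by rewrite lee_fin; exact: phi_convex.
move/leeD => /(_ _ _ (gconv x y t t01)) /le_trans; rewrite /F; apply.
by rewrite !muleDr// EFinD !EFinM addeACA.
Qed.

(** The epigraph of F is the preimage of that of g under the continuous map (x, r) -> (x, r - phi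
    x). *)
Lemma composite_closed : closed_fun g -> closed_fun F.
Proof.
move=> gcl.
rewrite /closed_fun (_ : epigraph F =
  (fun q : H * R => (q.1, q.2 - phi q.1)) @^-1` epigraph g).
  apply: preimage_closed => //.
  move=> q _; apply: (@cvg_pair _ _ _ _ (nbhs q.1) (nbhs (q.2 - phi q.1))).
    exact: cvg_fst.
  apply: cvgB; first exact: cvg_snd.
  by apply: continuous_comp; [exact: cvg_fst|exact: phi_cont].
apply/seteqP; split=> q; rewrite /epigraph /F /= EFinB.
  by rewrite leeBrDl.
by rewrite leeBrDl.
Qed.

Lemma composite_subdifferential x v :
  subdifferential dot g x v -> subdifferential dot F x (grad x + v).
Proof.
move=> vx u; rewrite /F dotDl EFinD addeACA.
by apply: leeD; [rewrite -EFinD lee_fin|exact: vx].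
Qed.

(** * Estimates for one inertial proximal gradient step *)

Section proximal_gradient_step.
Variables (lam : R) (x xm xp y z : H) (al be : R).
Hypothesis lam_gt0 : 0 < lam.
Hypothesis yE : y = x + be *: (x - xm).
Hypothesis zE : z = x + al *: (x - xm).
Hypothesis xpP :
  subdifferential dot g xp (lam^-1 *: (y - lam *: grad z - xp)).
Hypothesis lamL : lam * L <= 2.
Hypothesis al01 : 0 <= al <= 1.
Hypothesis be01 : 0 <= be <= 1.
Hypothesis lam_al : lam * al <= be / L.

Let xpE : lam^-1 *: (y - lam *: grad z - xp) = lam^-1 *: (y - xp) - grad z.
Proof.
by rewrite addrAC scalerBr scalerA mulVf ?gt_eqF// scale1r.
Qed.

(** Sum of three inequalities: the subgradient inequality of g at [xp], convexity of phi at [z], and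
    the descent lemma from [z] to [xp]. The terms in [grad z] cancel. *)
Lemma step_three_point u : g u \is a fin_num ->
  phi xp + fine (g xp) + lam^-1 * dot (y - xp) (u - xp) <=
  phi u + fine (g u) + L / 2 * `|xp - z| ^+ 2.
Proof.
move=> gu; have := subdifferential_fine g_proper xpP gu.
rewrite xpE (dotDl (lam^-1 *: _)) dotNl dotZl.
have := phi_grad z u; have := phi_descent z xp.
have -> : u - z = (u - xp) + (xp - z) by rewrite addrA subrK.
rewrite (dotDr (u - xp)).
by move: (`|_| ^+ 2) (lam^-1 * _) => *; lra.
Qed.

Let y_sub : y - xp = be *: (x - xm) - (xp - x).
Proof. by rewrite yE addrAC addrC opprB. Qed.

Let xp_sub : xp - z = (xp - x) - al *: (x - xm).
Proof. by rewrite zE opprD addrA. Qed.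

Lemma step_subgradient_norm :
  subdifferential dot F xp (grad xp - grad z + lam^-1 *: (y - xp)) /\
  `|grad xp - grad z + lam^-1 *: (y - xp)| <=
     (L + lam^-1) * (`|xp - x| + `|x - xm|).
Proof.
have /andP[al0 al1] := al01; have /andP[be0 be1] := be01.
split.
  by have := composite_subdifferential xpP; rewrite xpE addrA addrAC.
apply: le_trans (ler_normD _ _) _; rewrite mulrDl; apply: lerD.
  apply: le_trans (grad_lip _ _) _; rewrite ler_pM2l// xp_sub.
  apply: le_trans (ler_normB _ _) _; rewrite lerD2l normrZ ger0_norm//.
  by rewrite ler_piMl.
rewrite normrZ gtr0_norm ?invr_gt0// ler_pM2l ?invr_gt0// y_sub.
apply: le_trans (ler_normB _ _) _; rewrite addrC lerD2l normrZ ger0_norm//.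
by rewrite ler_piMl.
Qed.

(** The three-point inequality at u = [x], where [lam'] and [be'] stand for the parameters of the
    next step. *)
Lemma step_descent (lam' be' eps : R) : g x \is a fin_num ->
  0 <= be' -> lam <= lam' -> 0 < eps ->
  2 - lam * L * (1 - al) - be - be' >= eps ->
  phi xp + fine (g xp) + be' / (2 * lam') * `|xp - x| ^+ 2
    + eps * L / 4 * `|xp - x| ^+ 2 <=
  phi x + fine (g x) + be / (2 * lam) * `|x - xm| ^+ 2.
Proof.
move=> gx be'0 lam'P eps0 epsP.
have := step_three_point gx; rewrite y_sub xp_sub.
move: al01 be01 => /andP[al0 al1] /andP[be0 be1].
have -> : x - xp = - (xp - x) by rewrite opprB.
move: (x - xm) (xp - x) => d p.
rewrite !dotE -(sqr_norm hdot) (sqr_normB hdot) dotZr normrZ exprMn.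
rewrite real_normK ?num_real// (dotC p d).
have := young_dot hdot d p.
have N0 : 0 <= `|d| ^+ 2 by rewrite exprn_ge0.
have P0 : 0 <= `|p| ^+ 2 by rewrite exprn_ge0.
move: N0 P0; move: (`|d| ^+ 2) (`|p| ^+ 2) (dot d p) => N P D N0 P0 DNP h.
have i0 : 0 < lam^-1 by rewrite invr_gt0.
have il : lam^-1 * lam = 1 by rewrite mulVf ?gt_eqF.
have -> : be' / (2 * lam') = be' * lam'^-1 / 2 by rewrite invfM; ring.
have -> : be / (2 * lam) = be * lam^-1 / 2 by rewrite invfM; ring.
have lam'0 : 0 < lam' by exact: lt_le_trans lam'P.
have ii : lam'^-1 <= lam^-1 by rewrite lef_pV2 ?posrE.
(* The coupling of [lam], [al] and [be] makes the coefficient be/lam - al L of the cross term [D]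
   nonnegative, so Young's inequality applies to it in [h4]. *)
have alL : al * L <= be * lam^-1.
  by have := lam_al; rewrite !ler_pdivlMr//; lra.
have Li : L <= 2 * lam^-1.
  by have := lamL; rewrite ler_pdivlMr//; lra.
move: h lam'P epsP ii alL Li il i0; move: (lam^-1) (lam'^-1) => i i'.
move=> h lam'P epsP ii alL Li il i0.
have h1 : be' * i' <= be' * i by rewrite ler_wpM2l.
(* The step condition divided by [lam]; with lam L <= 2 this yields the decrease constant eps L / 4
   in [h7]. *)
have h2 : eps * i <= i * (2 - be - be') - L * (1 - al).
  have e : (i * lam) * (L * (1 - al)) = L * (1 - al) by rewrite il mul1r.
  by have := ler_wpM2r (ltW i0) epsP; lra.
have h3 : eps * L <= 2 * (eps * i) by have := ler_wpM2l (ltW eps0) Li; lra.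
have h4 : (be * i - al * L) * (2 * D) <= (be * i - al * L) * (N + P).
  by rewrite ler_wpM2l// subr_ge0.
have h5 : L * al ^+ 2 * N <= L * al * N.
  by rewrite ler_wpM2r// ler_wpM2l ?(ltW L_gt0)// expr2 ler_piMl.
have h6 : be' * i' * P <= be' * i * P by rewrite ler_wpM2r.
have h7 : eps * L / 4 * P <= (i * (2 - be - be') - L * (1 - al)) / 2 * P.
  by rewrite ler_wpM2r//; lra.
have h8 : be * i * N - L * al * N + L * al * N = be * i * N by ring.
lra.
Qed.

(** The three-point inequality at u = [p], multiplied by 2 lam. The constant 6 is 4 from bounding
    |xp - z|^2, plus 1 from Young's inequality on the cross term, plus 1 from be |x - xm|^2. *)
Lemma step_fejer (p : H) : g p \is a fin_num ->
  phi p + fine (g p) <= phi xp + fine (g xp) ->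
  `|xp - p| ^+ 2 - `|x - p| ^+ 2 <=
  be * (`|x - p| ^+ 2 - `|xm - p| ^+ 2)
    + 6 * (`|x - xm| ^+ 2 + `|xp - x| ^+ 2).
Proof.
move=> gp pmin.
have := step_three_point gp; rewrite y_sub xp_sub.
move: al01 be01 => /andP[al0 al1] /andP[be0 be1].
have xppE : xp - p = (x - p) + (xp - x) by rewrite [RHS]addrC subrKA.
have -> : xm - p = (x - p) - (x - xm) by rewrite opprB [RHS]addrC subrKA.
rewrite -(opprB xp p) xppE.
move: (x - xm) (xp - x) (x - p) => d q e.
rewrite (sqr_normD hdot e) (sqr_normB hdot e).
have : `|q - al *: d| ^+ 2 <= 2 * (`|q| ^+ 2 + `|d| ^+ 2).
  apply: le_trans (sqr_normD_le hdot _ _) _; rewrite ler_pM2l// lerD2l.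
  rewrite normrN normrZ exprMn ler_piMl ?exprn_ge0//.
  by rewrite expr_le1 ?normr_ge0// ger0_norm.
rewrite !dotE (dotC d e) (dotC q e) -(sqr_norm hdot q).
have := young_dot hdot d q.
have N0 : 0 <= `|d| ^+ 2 by rewrite exprn_ge0.
have P0 : 0 <= `|q| ^+ 2 by rewrite exprn_ge0.
have W0 : 0 <= `|q - al *: d| ^+ 2 by rewrite exprn_ge0.
move: N0 P0 W0.
move: (`|d| ^+ 2) (`|q| ^+ 2) (`|q - _| ^+ 2) (dot d q) (dot e d) (dot e q).
move=> N P W D A B N0 P0 W0 DNP WNP h.
have {h} : lam^-1 * (be * (- (A + D)) + (B + P)) <= L / 2 * W.
  by move: h pmin; move: (lam^-1) => *; lra.
rewrite ler_pdivrMl// => h.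
have : lam * (L / 2 * W) <= W by rewrite mulrA ler_piMl//; have := lamL; lra.
have : be * (2 * D) <= N + P.
  have [D0|D0] := leP 0 D; last by nra.
  by apply: le_trans DNP; rewrite ler_piMl// mulr_ge0.
have : be * N <= N by rewrite ler_piMl.
lra.
Qed.

End proximal_gradient_step.
End composite_objective.

(** * The iterates: summability, vanishing subgradients, weak convergence *)

Theorem theorem1 (R : realType) (H : completeNormedModType R)
    (dot : {dot H for idfun}) (hdot : inner_product dot)
    (f g : H -> \bar R)
    (f_proper : proper_fun f) (f_convex : econvex_fun f)
    (f_closed : closed_fun f)
    (g_proper : proper_fun g) (g_convex : econvex_fun g)
    (g_closed : closed_fun g)
    (dom_dg : dom_subdifferential dot g !=set0)
    (f_diff : forall x : H, frechet_differentiable f x)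
    (L : R) (L_gt0 : 0 < L) (f_lip : L.-lipschitz (gradient dot f)) :
  let F : H -> \bar R := fun x => (f x + g x)%E in
  let Fstar : \bar R := ereal_inf (range F) in
  let Xstar : set H := [set x | F x = Fstar] in
  forall (Fstar_gtNy : (-oo < Fstar)%E)
    (lambda alpha beta : nat -> R)
    (lambda_gt0 : forall k, (1 <= k)%N -> 0 < lambda k)
    (lambda_nd : forall k, (1 <= k)%N -> lambda k <= lambda k.+1)
    (eps gamma betabar : R) (eps_gt0 : 0 < eps)
    (gamma_bnd : 0 < gamma < 2) (betabar_bnd : 0 <= betabar < 1)
    (alpha_bnd : forall k, (1 <= k)%N -> 0 <= alpha k <= 1)
    (beta_bnd : forall k, (1 <= k)%N -> 0 <= beta k <= betabar)
    (lambda_alpha : forall k, (1 <= k)%N -> lambda k * alpha k <= beta k / L)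
    (lambda_bnd : forall k, (1 <= k)%N -> lambda k <= (2 - gamma) / L)
    (step_cond : forall k, (1 <= k)%N ->
      2 - lambda k * L * (1 - alpha k) - beta k - beta k.+1 >= eps)
    (x y z : nat -> H)
    (y_def : forall k, (1 <= k)%N ->
      y k.+1 = x k + beta k *: (x k - x k.-1))
    (z_def : forall k, (1 <= k)%N ->
      z k.+1 = x k + alpha k *: (x k - x k.-1))
    (x_def : forall k, (1 <= k)%N ->
      x k.+1 = prox (fun u => ((lambda k)%:E * g u)%E)
                    (y k.+1 - lambda k *: gradient dot f (z k.+1))),
  [/\ (\sum_(1 <= k <oo) (`|x k - x k.-1| ^+ 2)%:E < +oo)%E,
      dist0 (subdifferential dot F (x k)) @[k --> \oo] --> 0%E
    & Xstar !=set0 ->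
      exists2 xhat : H, Xstar xhat &
        [/\ weak_cvg dot x xhat, weak_cvg dot y xhat & weak_cvg dot z xhat] ].
move=> F Fstar Xstar Fstar_gtNy lam al be lam_gt0 lam_nd eps gam bbar eps_gt0.
move=> /andP[gam0 gam2] /andP[bbar0 bbar1] al_bnd be_bnd lam_al lam_bnd.
move=> step_cond.
move=> x y z yE zE xE.
have f_fin u : f u \is a fin_num by have [/nbhs_singleton] := f_diff u.
pose phi := fine \o f; pose grad := gradient dot f.
have fE u : f u = (phi u)%:E by rewrite /phi/= fineK.
have phi_diff u : differentiable phi u by have [] := f_diff u.
have phi_grad u w : 'd phi u w = dot (grad u) w by exact: gradientP.
have phi_convex u v (t : R) : 0 <= t <= 1 ->
    phi (t *: u + (1 - t) *: v) <= t * phi u + (1 - t) * phi v.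
  by move=> t01; rewrite -lee_fin EFinD !EFinM -!fE; exact: f_convex.
have phi_cont : continuous phi by move=> u; exact: differentiable_continuous.
have grad_le u v : phi u + dot (grad u) (v - u) <= phi v.
  by apply: convex_gradient_le => // t; exact: phi_convex.
have phi_descent u v :
    phi v <= phi u + dot (grad u) (v - u) + L / 2 * `|v - u| ^+ 2.
  exact: descent_le.
have grad_lip u v : `|grad u - grad v| <= L * `|u - v|.
  exact: (f_lip (u, v) (conj I I)).
have FE : F = fun u => ((phi u)%:E + g u)%E by apply/funext => u; rewrite /F fE.
have lamL k : (1 <= k)%N -> lam k * L <= 2.
  by move=> /lam_bnd; rewrite ler_pdivlMr//; lra.
have be01 k : (1 <= k)%N -> 0 <= be k <= 1.
  by move=> /be_bnd /andP[-> b]; apply: (le_trans b); exact: ltW.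
pose d k := x k - x k.-1.
have dS k : x k.+1 - x k = d k.+1 by [].
have xP k : (1 <= k)%N -> subdifferential dot g (x k.+1)
    ((lam k)^-1 *: (y k.+1 - lam k *: grad (z k.+1) - x k.+1)).
  move=> k1; rewrite (xE _ k1).
  exact: prox_subdifferential (lam_gt0 _ k1) dom_dg.
(* [x 0] and [x 1] are arbitrary and may lie outside dom g; proximal outputs start at index 2. *)
have gx k : (2 <= k)%N -> g (x k) \is a fin_num.
  case: k => [|[|k]]// _.
  exact: (subdifferential_fin_num g_proper (xP k.+1 isT)).
pose G k := phi (x k) + fine (g (x k)).
have FG k : (2 <= k)%N -> F (x k) = (G k)%:E.
  by move=> k2; rewrite FE -(fineK (gx _ k2)).
have Fstar_le u : (Fstar <= F u)%E by apply: ereal_inf_lbound; exists u.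
have [m mE] : exists m : R, Fstar = m%:E.
  have := Fstar_le (x 2); rewrite FG//.
  by move: Fstar_gtNy; case: (Fstar) => [r _ _|//|//]; exists r.
have m_le k : (2 <= k)%N -> m <= G k.
  by move=> k2; rewrite -lee_fin -mE -FG.
(* Indices are shifted so that the energy [e 0] sits at [x 2], the first iterate known to have a
   finite objective. *)
pose a n := `|d n.+3| ^+ 2.
pose e n := G n.+2 + be n.+2 / (2 * lam n.+2) * `|d n.+2| ^+ 2.
have ea n : e n.+1 + eps * L / 4 * a n <= e n.
  have n1 : (1 <= n.+2)%N by [].
  have /andP[b0 _] := be01 n.+3 isT.
  exact: (step_descent hdot L_gt0 grad_le phi_descent g_proper (lam_gt0 _ n1)
    (yE _ n1) (zE _ n1) (xP _ n1) (lamL _ n1) (al_bnd _ n1) (be01 _ n1)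
    (lam_al _ n1) (gx n.+2 isT) b0 (lam_nd _ n1) eps_gt0 (step_cond _ n1)).
have em n : m <= e n.
  rewrite /e ler_wpDr ?m_le// mulr_ge0 ?exprn_ge0//.
  have /andP[b0 _] := be01 n.+2 isT.
  by rewrite divr_ge0// mulr_ge0// ltW// lam_gt0.
have [D aD] : exists D, forall n, series a n <= D.
  have c0 : 0 < eps * L / 4 by rewrite !mulr_gt0.
  by exists ((e 0%N - m) / (eps * L / 4)); exact: descent_series_bounded.
have a0 n : 0 <= a n by rewrite exprn_ge0.
have acvg0 : a n @[n --> \oo] --> 0.
  by apply: cvg_series_cvg_0; exact: nneg_series_bounded_cvg aD.
have dcvg0 : `|d n| @[n --> \oo] --> 0.
  have := cvg_comp _ _ acvg0 (@sqrt_continuous R 0).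
  rewrite sqrtr0 (_ : _ \o _ = [sequence `|d (n + 3)%N|]_n).
    by rewrite (@cvg_shiftn 3 _ (fun n => `|d n|)).
  by apply/funext => n; rewrite /a /= sqrtr_sqr normr_id addn3.
(* The first two increments escape the energy estimate and are added separately. *)
pose B := `|d 1| ^+ 2 + `|d 2| ^+ 2 + D.
have sumB n : \sum_(1 <= k < n) `|d k| ^+ 2 <= B.
  have sum3 : \sum_(1 <= k < n.+3) `|d k| ^+ 2 =
      `|d 1| ^+ 2 + `|d 2| ^+ 2 + series a n.
    elim: n => [|n ih].
      by rewrite big_ltn// big_ltn// big_geq// seriesEnat/= big_geq// !addr0.
    by rewrite big_nat_recr//= ih seriesSr addrA.
  apply: (@le_trans _ _ (\sum_(1 <= k < n.+3) `|d k| ^+ 2)); last first.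
    by rewrite sum3 lerD2l.
  case: n {sum3} => [|n]; first by rewrite big_geq// sumr_ge0.
  rewrite [leRHS](@big_cat_nat _ _ _ n.+1)//= ?lerDl ?sumr_ge0//.
  by rewrite -addn3 leq_addr.
(* Monotonicity bounds 1/lam k by 1/lam 1, which makes the constant [K] uniform in k. *)
have kap k : (1 <= k)%N -> lam 1%N <= lam k.
  by elim: k => [//|[//|k] ih _]; apply: (le_trans (ih _)) => //; exact: lam_nd.
pose s k := grad (x k.+1) - grad (z k.+1) + (lam k)^-1 *: (y k.+1 - x k.+1).
pose K := L + (lam 1%N)^-1.
have sP k : (1 <= k)%N -> subdifferential dot F (x k.+1) (s k) /\
    `|s k| <= K * (`|d k.+1| + `|d k|).
  move=> k1; rewrite FE.
  have [sk sle] := step_subgradient_norm L_gt0 grad_le grad_lip (lam_gt0 _ k1)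
    (yE _ k1) (zE _ k1) (xP _ k1) (al_bnd _ k1) (be01 _ k1).
  split=> //; apply: (le_trans sle); rewrite ler_wpM2r ?addr_ge0//.
  by rewrite lerD2l lef_pV2 ?posrE ?lam_gt0// kap.
have Kd0 : K * (`|d n.+1| + `|d n|) @[n --> \oo] --> 0.
  rewrite -(mulr0 K) -[X in _ * X](addr0 0).
  apply: cvgMl_tmp; apply: cvgD => //.
  by rewrite (@cvg_shiftS _ (fun n => `|d n|)).
split.
- apply: (@le_lt_trans _ _ B%:E); last exact: ltry.
  apply: lime_le.
    by apply: is_cvg_nneseries => n _ _; rewrite lee_fin exprn_ge0.
  by apply: nearW => n; rewrite sumEFin lee_fin.
- have : dist0 (subdifferential dot F (x n.+1)) @[n --> \oo] --> 0%E.
    apply: (@squeeze_cvge _ _ _ _ (fun=> 0%E) _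
      (fun n => (K * (`|d n.+1| + `|d n|))%:E)); last 2 first.
    - exact: cvg_cst.
    - by apply: cvg_EFin; [exact: nearW|exact: Kd0].
    exists 1%N => // n /= n1; apply/andP; split.
      by apply: le_ereal_inf_tmp => _ [v _ <-]; rewrite lee_fin.
    have [sn snle] := sP n n1.
    apply: (@le_trans _ _ `|s n|%:E); last by rewrite lee_fin.
    by apply: ereal_inf_lbound; exists (s n).
  by rewrite (@cvg_shiftS _ (fun n => dist0 (subdifferential dot F (x n)))).
have Xfin p : Xstar p -> g p \is a fin_num.
  by rewrite /Xstar/= FE mE; case: (g p).
have Xm p : Xstar p -> phi p + fine (g p) = m.
  move=> pX; apply: EFin_inj; rewrite EFinD (fineK (Xfin _ pX)) -mE.
  by move: pX; rewrite /Xstar/= FE.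
have fejer p : Xstar p -> cvgn (fun n => `|x n - p| ^+ 2).
  move=> pX.
  (* Passing from [x n.+1] to [x n.+2] uses the parameters of index [n.+1]; each of the two shifted
     sums of squared increments is at most [B]. *)
  apply: (@inertial_sequence_cvg _ _
    (fun n => 6 * (`|d n.+1| ^+ 2 + `|d n.+2| ^+ 2))
    (fun n => be n.+1) bbar (6 * (B + B))) => //.
  - move=> n; rewrite seriesEnat/= -mulr_sumr ler_pM2l// big_split/=.
    apply: lerD.
      by rewrite -(big_add1 _ _ 0 n.+1 xpredT (fun k => `|d k| ^+ 2)).
    have := sumB n.+2; rewrite (@big_ltn _ _ _ 1)// big_add1 big_add1/=.
    apply: le_trans.
    by rewrite lerDr exprn_ge0.
  - by move=> n; exact: be_bnd.
  move=> n; apply: (step_fejer hdot grad_le phi_descent g_proper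
    (lam_gt0 n.+1 isT) (yE n.+1 isT) (zE n.+1 isT) (xP n.+1 isT) (lamL n.+1 isT)
    (al_bnd n.+1 isT) (be01 n.+1 isT) (Xfin _ pX)).
  by rewrite Xm// m_le.
move=> [p0 p0X].
have [M0 xM0] : exists M, forall n, `|x n - p0| <= M.
  have /cvg_seq_bounded/pinfty_ex_gt0[M M0 hM] := fejer _ p0X.
  exists (M + 1) => n; have := hM n I.
  rewrite /= ger0_norm ?exprn_ge0//; have := normr_ge0 (x n - p0).
  by move: (`|_|) => t; nra.
have xM n : `|x n| <= M0 + `|p0|.
  by rewrite -(subrK p0 (x n)) (le_trans (ler_normD _ _))// lerD2r.
have F_proper : proper_fun F by rewrite FE; exact: composite_proper.
have F_convex : econvex_fun F by rewrite FE; exact: composite_convex.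
have F_closed : closed_fun F by rewrite FE; exact: composite_closed.
(* The subgradient inequality at [x n.+1] tested at the minimizer [p0] gives G(n+1) - m <= |s n| M0,
   which tends to 0. *)
have Gm : G n @[n --> \oo] --> m.
  rewrite -(@cvg_shiftS _ (fun n => G n)).
  apply: (@squeeze_cvgr _ _ _ _ (fun=> m)
    (fun n => m + K * (`|d n.+1| + `|d n|) * M0)); last 2 first.
  - exact: cvg_cst.
  - rewrite -[X in _ --> X]addr0 -[X in _ + X](mul0r M0).
    by apply: cvgD; [exact: cvg_cst|apply: cvgMr_tmp].
  exists 1%N => // n /= n1; rewrite m_le//=.
  have [sn snle] := sP n n1.
  have Fp : F p0 \is a fin_num by rewrite p0X mE.
  have := subdifferential_fine F_proper sn Fp.
  rewrite p0X mE FG//= => le_m.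
  have : dot (s n) (x n.+1 - p0) <= K * (`|d n.+1| + `|d n|) * M0.
    apply: le_trans (dot_le_norm hdot _ _) _.
    by apply: ler_pM.
  by rewrite -(opprB p0) dotNr; move: (K * _ * _) le_m => r; lra.
(* A weak limit c equals q = prox_F(c), since |c - q|^2 <= F^* - F(q) <= 0. *)
have [xh Xxh wx] : exists2 c, Xstar c & weak_cvg dot x c.
  apply: (opial hdot xM fejer) => U c UU ooU cP.
  have [q qmin] : exists q, forall u, ((`|q - c| ^+ 2 / 2)%:E + 1%:E * F q <=
      (`|u - c| ^+ 2 / 2)%:E + 1%:E * F u)%E.
    apply: (@prox_minimizer_exists _ _ _ hdot F F_proper F_convex F_closed
      1 m) => // u.
    by rewrite mul1e -mE (le_trans (Fstar_le u))// leeDr// lee_fin divr_ge0.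
  have := minimizer_subdifferential hdot F_proper F_convex ltr01 qmin.
  rewrite invr1 scale1r => cq.
  have Fq := subdifferential_fin_num F_proper cq.
  have mq : m <= fine (F q) by rewrite -lee_fin fineK// -mE.
  (* Limit along [U] of the subgradient inequality for c - q at [q], evaluated at [x n]; only the
     weak limit of [x n] and [Gm] enter. *)
  have : fine (F q) + (dot c (c - q) - dot q (c - q)) <= m.
    apply: (@ler_cvg_to _ U _ _
      (fun n => fine (F q) + (dot (x n) (c - q) - dot q (c - q))) G).
    - apply: cvgD; first exact: cvg_cst.
      by apply: cvgB; [exact: cP|exact: cvg_cst].
    - by move=> A mA; apply: ooU; exact: Gm mA.
    apply: ooU; exists 2 => // n /= n2.
    have Fx : F (x n) \is a fin_num by rewrite FG.
    have := subdifferential_fine F_proper cq Fx.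
    by rewrite FG//= (dotC _ (x n - q)) dotDl dotNl.
  rewrite -dotNl -dotDl -(sqr_norm hdot) => le_m.
  have cq0 : `|c - q| ^+ 2 = 0.
    by apply/eqP; rewrite eq_le exprn_ge0// andbT; lra.
  have cqE : c = q by apply/eqP; rewrite -subr_eq0 -normr_eq0 -sqrf_eq0 cq0.
  rewrite /Xstar/= mE cqE -(fineK Fq); congr (_%:E).
  by apply/eqP; rewrite eq_le mq andbT -(addr0 (fine _)) -[X in _ + X]cq0.
exists xh => //.
(* Serves both [y] and [z]: the correction c k (x k - x k.-1) tends to 0 in norm. The shift by one
   is needed because the recursion starts at k = 1. *)
have weak_extrapolation (c : nat -> R) (v : nat -> H) :
    (forall k, (1 <= k)%N -> 0 <= c k <= 1) ->
    (forall k, (1 <= k)%N -> v k.+1 = x k + c k *: (x k - x k.-1)) ->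
    weak_cvg dot v xh.
  move=> c01 vE w.
  rewrite -(@cvg_shiftS _ (fun n => dot (v n) w)).
  apply: (@cvg_trans _ ((fun n => dot (x n) w + c n * dot (d n) w) @ \oo)).
    apply: near_eq_cvg; exists 1%N => // n /= n1.
    by rewrite vE// (dotDl (x n) (c n *: _)) dotZl.
  rewrite -[dot xh w]addr0; apply: cvgD; first exact: wx.
  apply: norm_cvg0.
  apply: (@squeeze_cvgr _ _ _ _ (fun=> 0) (fun n => `|d n| * `|w|));
    last 2 first.
  - exact: cvg_cst.
  - by rewrite -(mul0r `|w|); apply: cvgMr_tmp.
  exists 1%N => // n /= n1; rewrite normr_ge0/= normrM.
  have /andP[c0 c1] := c01 n n1.
  apply: le_trans (norm_dot_le hdot _ _); rewrite ler_piMl// ger0_norm//.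
split=> //.
- exact: weak_extrapolation yE.
- exact: weak_extrapolation al_bnd zE.
Qed.
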